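(* Let $G=(V,E)$ be a finite connected $d$-regular graph, $A\subset V$ nonempty with $|A|\le|V|/2$ achieving $h_{out}=h_{out}(G)=|\partial_{out}A|/|A|$, and $\Sigma=\partial_{out}A$. Let $\nu:\mathbb{Z}_{\ge0}\to(0,\infty)$ be such that for both choices $V^+=A$, $V^-=V\setminus(A\cup\Sigma)$ and $V^+=V\setminus(A\cup\Sigma)$, $V^-=A$, one has $|\mathrm{dist}_\Sigma^{-1}(k)|\le|\Sigma|\nu(k)$ for all $k\ge0$. Let $T$ be the largest integer with $1>h_{out}\sum_{i=0}^T\nu(i)$. Then $$\lambda_2(G)\le\frac{1}{2B},\qquad B=\sup_{n\ge1}\Bigl(\sum_{k=n}^T\Bigl(1-h_{out}\sum_{i=0}^k\nu(i)\Bigr)\Bigr)\Bigl(\sum_{k=1}^n\frac{1}{\nu(k)+\nu(k-1)}\Bigr).$$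
   Context: $\partial_{out}A=\{y\notin A:\exists x\in A,\ x\sim y\}$; $h_{out}(G)=\min|\partial_{out}A|/|A|$ over nonempty $A$ with $|A|\le|V|/2$. The signed distance $\mathrm{dist}_\Sigma$ has absolute value equal to the graph distance to $\Sigma$, positive on $V^+$ and negative on $V^-$. The normalized Laplacian is $\Delta f(x)=\frac1d\sum_{y\sim x}(f(x)-f(y))$ with eigenvalues $0=\lambda_1\le\lambda_2\le\cdots$. *)

(* Defs.v *)
From HB Require Import structures.
From mathcomp Require Import all_boot all_order all_algebra.
From mathcomp Require Import polyrcf.
From mathcomp Require Import boolp classical_sets reals constructive_ereal ereal.

Set Implicit Arguments.
Unset Strict Implicit.
Unset Printing Implicit Defensive.

Import Order.TTheory GRing.Theory Num.Theory.
Local Open Scope ring_scope.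

Definition simple_graph (V : finType) (e : rel V) : Prop :=
  symmetric e /\ irreflexive e.

Definition connected_graph (V : finType) (e : rel V) : Prop :=
  forall x y : V, connect e x y.

Definition regular_graph (V : finType) (e : rel V) (d : nat) : Prop :=
  forall x : V, #|[set y | e x y]| = d.

Definition outer_boundary (V : finType) (e : rel V) (A : {set V}) : {set V} :=
  [set y | (y \notin A) && [exists x in A, e x y]].

Definition expansion_ratio (R : realType) (V : finType) (e : rel V)
    (A : {set V}) : R :=
  #|outer_boundary e A|%:R / #|A|%:R.

Definition admissible (V : finType) (A : {set V}) : bool :=
  (A != finset.set0) && (2 * #|A| <= #|V|)%N.

(* The infimum is a minimum: the set of values is finite, and it is nonempty
   as soon as [V] has two elements. *)
Definition h_out (R : realType) (V : finType) (e : rel V) : R :=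
  inf [set r : R | exists2 A : {set V}, admissible A & r = expansion_ratio R e A]%classic.

(* Least length of a walk from [x] to [y]; the value is [#|V|], which is larger
   than any actual distance, if there is none. *)
Definition graph_dist (V : finType) (e : rel V) (x y : V) : nat :=
  find (fun n => [exists p : n.-tuple V, path e x p && (last x p == y)])
       (iota 0 #|V|).

Definition dist_to_set (V : finType) (e : rel V) (S : {set V}) (x : V) : nat :=
  \big[minn/#|V|]_(s in S) graph_dist e x s.

(* [Vplus], [Vminus] and [S] partition [V] in all uses; on [S] the value is 0. *)
Definition signed_dist (V : finType) (e : rel V) (S Vplus Vminus : {set V})
    (x : V) : int :=
  if x \in Vplus then (dist_to_set e S x)%:Z
  else if x \in Vminus then - (dist_to_set e S x)%:Z
  else 0.

Definition level_bound (R : realType) (V : finType) (e : rel V)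
    (S Vplus Vminus : {set V}) (nu : nat -> R) : Prop :=
  forall k : nat,
    #|[set x | signed_dist e S Vplus Vminus x == k%:Z]|%:R <= #|S|%:R * nu k.

Definition laplacian (R : realType) (V : finType) (e : rel V) (d : nat)
    (f : V -> R) (x : V) : R :=
  d%:R^-1 * \sum_(y | e x y) (f x - f y).

(* Column [j] is the image of the indicator function of the [j]-th vertex. *)
Definition laplacian_mx (R : realType) (V : finType) (e : rel V) (d : nat) :
    'M[R]_#|V| :=
  \matrix_(i, j) laplacian e d (fun x => (x == enum_val j)%:R) (enum_val i).

(* [rootsR p] lists the distinct real roots of [p] in increasing order, so this
   is the nondecreasing list of the real eigenvalues with algebraic multiplicity;
   it has length [n] when [M] is symmetric. *)
Definition real_eigenvalues (R : realType) (n : nat) (M : 'M[R]_n) : seq R :=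
  flatten [seq nseq (mup x (char_poly M)) x | x <- rootsR (char_poly M)].

(* Eigenvalues are numbered from 1. *)
Definition lambda_ (R : realType) (V : finType) (e : rel V) (d k : nat) : R :=
  nth 0 (real_eigenvalues (laplacian_mx R e d)) k.-1.

(* The sum of [F k] for [m <= k <= T]; it is empty when [T < m], in particular
   when [T] is negative. *)
Definition sum_upto (R : realType) (m : nat) (T : int) (F : nat -> R) : R :=
  if T is Posz t then \sum_(m <= k < t.+1) F k else 0.

Definition is_largest_int (P : int -> Prop) (T : int) : Prop :=
  P T /\ forall T' : int, P T' -> T' <= T.

(* The constant B; the supremum is taken in the extended reals so that 1/(2B)
   makes sense as +oo when B = 0, i.e. when every first factor is an empty sum. *)
Definition hardy_const (R : realType) (h : R) (nu : nat -> R) (T : int) : \bar R :=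
  ereal_sup [set b : \bar R | exists2 n : nat, (1 <= n)%N &
    b = (sum_upto n T (fun k => 1 - h * \sum_(0 <= i < k.+1) nu i)
         * \sum_(1 <= k < n.+1) (nu k + nu k.-1)^-1)%:E]%classic.

(* Main.v *)
Require Import Defs.
From HB Require Import structures.
From mathcomp Require Import all_boot all_order all_algebra.
From mathcomp Require Import complex polyrcf.
From mathcomp Require Import boolp classical_sets reals constructive_ereal ereal.
From mathcomp Require Import ring lra zify.
Import Order.TTheory GRing.Theory Num.Theory.
Local Open Scope ring_scope.

Set Implicit Arguments.
Unset Strict Implicit.
Unset Printing Implicit Defensive.

(** Write [S] for the boundary of [A] and let [P] be either side, [A] or
    [~: (A :|: S)]. Let [L_k] be the set of points of [P :|: S] at distance [k]
    from [S], and, for fixed [n], let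
    [g k = \sum_(1 <= j <= min k n) 1 / (nu j + nu (j - 1))].
    The test function [g (dist_S)] on [P], extended by 0, has
    - Dirichlet energy at most [|S| g(n) / 2], because [d]-regularity bounds the
      contribution of [L_k] by [|L_k|] times the squares of the two increments of
      [g] next to [k], and [|L_k| <= |S| nu k];
    - squared norm at least [g(n)^2 \sum_(k >= n) |L_k|], and
      [|L_k| >= |S| (1 - h \sum_(i <= k) nu i)]: the outer boundaries of
      [{dist_S > k}] and of its complement deprived of [L_k] both lie in [L_k],
      so one applies the isoperimetric inequality to the first set if it has at
      most half of the vertices and to the second one otherwise.
    The two test functions live on sides that no edge joins, so they are
    orthogonal for both forms and [lambda_2] is at most the larger of their
    Rayleigh quotients. *)

(** * Eigenvalues of real symmetric matrices *)

Lemma mup_prod_XsubC (F : fieldType) (s : seq F) (x : F) :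
  mup x (\prod_(y <- s) ('X - y%:P)) = count_mem x s.
Proof.
elim: s => [|y s IH]; first by rewrite big_nil mupNroot //= root1.
rewrite big_cons mupM ?polyXsubC_eq0 ?monic_neq0 ?monic_prod_XsubC // IH.
by have := mup_XsubCX 1 x y; rewrite expr1 => -> /=; case: eqP.
Qed.

(** The listed roots are distinct, so only the block of [x] itself contributes; for a non-root both
    sides are 0. *)
Lemma count_mem_real_eigenvalues (R : realType) n (M : 'M[R]_n) x :
  count_mem x (real_eigenvalues M) = mup x (char_poly M).
Proof.
have p0 : char_poly M != 0 by rewrite monic_neq0 // char_poly_monic.
rewrite /real_eigenvalues count_flatten -map_comp sumnE big_map.
under eq_bigr => y _ do rewrite /= count_nseq.
have := roots_on_rootsR p0 x; rewrite in_itv /= => rx.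
have un : uniq (rootsR (char_poly M)).
  by apply: (@sorted_uniq _ <%R); [exact: lt_trans|exact: lt_irreflexive|exact: sorted_roots].
case: (boolP (x \in rootsR (char_poly M))) => xin.
  rewrite (bigD1_seq x) //= eqxx mul1n big1 ?addn0 // => y /negPf yx.
  by rewrite yx mul0n.
rewrite mupNroot; last by rewrite rx.
rewrite big_seq big1 // => y yin; case: eqP => [yx|_]; last by rewrite mul0n.
by rewrite -yx yin in xin.
Qed.

Lemma sorted_real_eigenvalues (R : realType) n (M : 'M[R]_n) :
  sorted <=%R (real_eigenvalues M).
Proof.
rewrite sorted_pairwise; last exact: le_trans.
have : pairwise <%R (rootsR (char_poly M)).
  by rewrite -sorted_pairwise; [exact: sorted_roots|exact: lt_trans].
rewrite /real_eigenvalues; elim: (rootsR _) => //= x s IH /andP[/allP xs /IH ps].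
rewrite pairwise_cat ps andbT; apply/andP; split; last first.
  by elim: (mup _ _) => //= k ->; rewrite andbT; apply/allP => y /nseqP[-> _].
apply/allrelP => y z /nseqP[-> _] /flattenP[t /mapP[w ws ->] /nseqP[-> _]].
exact/ltW/xs.
Qed.

Lemma real_eigenvalues_perm (R : realType) n (M : 'M[R]_n) (s : seq R) :
  char_poly M = \prod_(y <- s) ('X - y%:P) -> perm_eq (real_eigenvalues M) s.
Proof.
move=> cM; apply/allP => x _ /=.
by rewrite count_mem_real_eigenvalues cM mup_prod_XsubC.
Qed.

Local Open Scope sesquilinear_scope.

(** Seen over [R[i]], a real symmetric matrix is Hermitian, so the complex spectral theorem applies
    and its spectrum is real. *)
Lemma symmetric_unitary_diag (R : rcfType) n (M : 'M[R]_n) : M^T = M ->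
  exists (P : 'M[R[i]]_n) (r : 'rV[R]_n), P \is unitarymx /\
    map_mx (real_complex R) M = P^t* *m diag_mx (map_mx (real_complex R) r) *m P.
Proof.
move=> Msym; set N := M ^ _.
have Nherm : N \is hermsymmx.
  apply: realsym_hermsym.
    by apply/is_hermitianmxP; rewrite expr0 scale1r map_mx_id // map_trmx Msym.
  by apply/mxOverP => i j; rewrite mxE complex_real.
have /hermitian_normalmx/orthomx_spectralP Neq := Nherm.
have /mxOverP dreal := hermitian_spectral_diag_real Nherm.
exists (spectralmx N), (map_mx (@complex.Re R) (spectral_diag N)).
split; first exact: spectral_unitarymx.
rewrite {1}Neq invmx_unitary ?spectral_unitarymx //; congr (_ *m diag_mx _ *m _).
by apply/matrixP => i j; rewrite !mxE RRe_real.
Qed.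

(** Similar matrices share their characteristic polynomial; the identity is checked over [R[i]] and
    descends because [real_complex] is injective. *)
Lemma char_poly_unitary_diag (R : rcfType) n (M : 'M[R]_n)
    (P : 'M[R[i]]_n) (r : 'rV[R]_n) : P \is unitarymx ->
  map_mx (real_complex R) M = P^t* *m diag_mx (map_mx (real_complex R) r) *m P ->
  char_poly M = \prod_(i < n) ('X - (r 0 i)%:P).
Proof.
move=> Pu Meq; apply: (@map_poly_inj _ _ (real_complex R)).
rewrite map_char_poly [RHS]rmorph_prod /=.
transitivity (char_poly (diag_mx (map_mx (real_complex R) r))); last first.
  rewrite char_poly_trig; last by rewrite diag_mx_is_trig.
  apply: eq_bigr => i _; rewrite !mxE eqxx mulr1n.
  by rewrite rmorphB /= map_polyX map_polyC.
have PP : P^t* *m P = 1%:M.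
  by have := invmx_unitary Pu => <-; rewrite mulVmx // unitarymx_unit.
have PpP : map_mx polyC (P^t*) *m map_mx polyC P = 1%:M.
  by rewrite -map_mxM PP map_mx1.
rewrite /char_poly /char_poly_mx Meq !map_mxM /=.
set D := map_mx polyC (P^t*) in PpP *; set E := map_mx polyC P in PpP *.
have -> : 'X%:M - D *m map_mx polyC (diag_mx (map_mx (real_complex R) r)) *m E =
   D *m ('X%:M - map_mx polyC (diag_mx (map_mx (real_complex R) r))) *m E.
  rewrite mulmxBr mulmxBl; congr (_ - _).
  by rewrite mul_mx_scalar -scalemxAl PpP scalemx1.
by rewrite !det_mulmx mulrAC -det_mulmx PpP det1 mul1r.
Qed.

(** The cross terms vanish. It serves both for the energy ([N] the matrix itself) and for the
    squared norm ([N] the identity). *)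
Lemma form_combination (R : rcfType) n (N : 'M[R]_n) (u v : 'rV[R]_n) (a b : R[i]) :
  u *m N *m v^T = 0 -> v *m N *m u^T = 0 ->
  let w := a *: (map_mx (real_complex R) u) + b *: (map_mx (real_complex R) v) in
  (w *m (map_mx (real_complex R) N) *m w^t*) 0 0 =
  `|a| ^+ 2 * ((u *m N *m u^T) 0 0)%:C%C + `|b| ^+ 2 * ((v *m N *m v^T) 0 0)%:C%C.
Proof.
move=> uv vu w.
have tr (x : 'rV[R]_n) : (map_mx (real_complex R) x)^t* = x^T ^ real_complex R.
  by apply/matrixP => i j; rewrite !mxE; exact: conjc_real.
rewrite /w linearD /= map_mxD !linearZ /= !map_mxZ /= !tr !(mulmxDl, mulmxDr).
rewrite -!scalemxAl -!scalemxAr -!map_mxM uv vu map_mx0.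
by rewrite !scaler0 addr0 add0r !normCK !mxE !mulrA.
Qed.

Lemma form_unitary_diag (R : rcfType) n (P : 'M[R[i]]_n) (r : 'rV[R]_n) (w : 'rV[R[i]]_n) :
  (w *m (P^t* *m diag_mx (map_mx (real_complex R) r) *m P) *m w^t*) 0 0 =
  \sum_i (r 0 i)%:C%C * `|(w *m P^t*) 0 i| ^+ 2.
Proof.
set z := w *m P^t*.
have -> : w *m (P^t* *m diag_mx (map_mx (real_complex R) r) *m P) *m w^t* =
   z *m diag_mx (map_mx (real_complex R) r) *m z^t*.
  by rewrite /z trmx_mul map_mxM /= trmxCK !mulmxA.
rewrite mxE; apply: eq_bigr => i _.
rewrite mul_mx_diag !mxE normCK.
by rewrite -mulrA mulrCA.
Qed.

(** Only the head of a sorted list can lie strictly below its second entry. Positivity excludes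
    lists with fewer than two entries, where [nth] returns the default 0. *)
Lemma count_lt_nth1 (R : realType) (s : seq R) : sorted <=%R s ->
  0 < nth 0 s 1 -> (count (fun x => (x < nth 0 s 1)%R) s <= 1)%N.
Proof.
case: s => [|x [|y s]] /=; rewrite ?ltxx // => /andP[xy ys] y0.
have -> : count (fun x => x < y) s = 0%N.
  apply/eqP; rewrite -leqn0 leqNgt -has_count; apply/hasPn => z zs /=.
  by rewrite -leNgt; have /allP := order_path_min le_trans ys; apply.
by case: (x < y).
Qed.

(** Min-max principle on the plane spanned by [u] and [v]. If the second eigenvalue [l] exceeded
    [c], at most one eigenvalue would be below [l], and a nonzero [w] of the plane orthogonal to its
    eigenvector would have Rayleigh quotient both at least [l] and at most [c]. *)
Lemma nth1_real_eigenvalues_le (R : realType) n (M : 'M[R]_n) (u v : 'rV[R]_n) (c : R) :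
  M^T = M -> 0 <= c -> u != 0 -> v != 0 ->
  u *m v^T = 0 -> u *m M *m v^T = 0 ->
  (u *m M *m u^T) 0 0 <= c * (u *m u^T) 0 0 ->
  (v *m M *m v^T) 0 0 <= c * (v *m v^T) 0 0 ->
  nth 0 (real_eigenvalues M) 1 <= c.
Proof.
move=> Msym c0 u0 v0 uv uMv cu cv; rewrite leNgt; apply/negP => clt.
set l := nth _ _ _ in clt.
have [P [r [Pu Meq]]] := symmetric_unitary_diag Msym.
have pe : perm_eq (real_eigenvalues M) [seq r 0 i | i <- enum 'I_n].
  apply: real_eigenvalues_perm; rewrite (char_poly_unitary_diag Pu Meq).
  by rewrite big_map big_enum.
have cl1 : (#|[set i | (r 0 i < l)%R]| <= 1)%N.
  have := count_lt_nth1 (sorted_real_eigenvalues M) (le_lt_trans c0 clt).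
  rewrite -/l (permP pe) count_map; apply: leq_trans.
  rewrite cardsE cardE -size_filter {1}/enum_mem -enumT.
  exact: leqnn.
have sqpos (x : 'rV[R]_n) : x != 0 -> 0 < (x *m x^T) 0 0.
  move=> x0; rewrite lt_neqAle eq_sym; apply/andP; split.
    apply: contra x0; rewrite mxE => /eqP/psumr_eq0P xx.
    apply/eqP/rowP => i; rewrite mxE; apply/eqP; rewrite -[_ == _]sqrf_eq0 expr2.
    by have := xx _ i isT; rewrite mxE => -> // j _; rewrite mxE -expr2 sqr_ge0.
  by rewrite mxE sumr_ge0 // => i _; rewrite mxE -expr2 sqr_ge0.
(* If no eigenvalue is below [l], any index serves; [u != 0] provides one. *)
have [i0 hi0] : exists i0 : 'I_n, forall i, i != i0 -> l <= r 0 i.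
  have /rV0Pn[n0 _] := u0.
  have [/eqP|/set0Pn[i0 i0in]] := boolP ([set i | r 0 i < l] == finset.set0).
    move=> e0; exists n0 => i _; rewrite leNgt; apply/negP => ri.
    have : i \in [set i | r 0 i < l] by rewrite inE.
    by rewrite e0 finset.in_set0.
  exists i0 => i ii0; rewrite leNgt; apply/negP => ri.
  by case/eqP: ii0; apply: (card_le1_eqP cl1); rewrite ?inE // in i0in *.
have vu : v *m u^T = 0 by apply: trmx_inj; rewrite trmx_mul trmxK uv trmx0.
have vMu : v *m M *m u^T = 0.
  by apply: trmx_inj; rewrite !trmx_mul trmxK Msym mulmxA uMv trmx0.
pose zu := ((map_mx (real_complex R) u) *m P^t*) 0 i0.
pose zv := ((map_mx (real_complex R) v) *m P^t*) 0 i0.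
(* A combination of [u] and [v] orthogonal to the only eigenvector whose
   eigenvalue may be below [l]. *)
have [a [b [ab azbz]]] : exists a b : R[i], (a != 0) || (b != 0) /\ a * zu + b * zv = 0.
  case: (eqVneq zu 0) => [->|zu0].
    by exists 1, 0; rewrite oner_eq0 mulr0 mul0r addr0.
  by exists zv, (- zu); rewrite oppr_eq0 zu0 orbT mulNr mulrC subrr.
pose w := a *: (map_mx (real_complex R) u) + b *: (map_mx (real_complex R) v).
have wz0 : (w *m P^t*) 0 i0 = 0.
  by rewrite /w mulmxDl -!scalemxAl mxE [X in X + _]mxE [X in _ + X]mxE.
have E1 : \sum_i (r 0 i)%:C%C * `|(w *m P^t*) 0 i| ^+ 2 =
  `|a| ^+ 2 * ((u *m M *m u^T) 0 0)%:C%C + `|b| ^+ 2 * ((v *m M *m v^T) 0 0)%:C%C.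
  by rewrite -form_unitary_diag -Meq; exact: form_combination.
have E2 : \sum_i `|(w *m P^t*) 0 i| ^+ 2 =
  `|a| ^+ 2 * ((u *m u^T) 0 0)%:C%C + `|b| ^+ 2 * ((v *m v^T) 0 0)%:C%C.
  have /= E := @form_combination _ _ 1%:M u v a b.
  rewrite !mulmx1 map_mx1 mulmx1 in E; rewrite -(E uv vu) -/w.
  have -> : w *m w^t* = (w *m P^t*) *m (w *m P^t*)^t*.
    by rewrite trmx_mul map_mxM /= trmxCK mulmxA mulmxKtV.
  by rewrite [RHS]mxE; apply: eq_bigr => i _; rewrite normCK !mxE.
set W := \sum_i _ in E2.
have Wpos : 0 < W.
  rewrite E2; have Ca : 0 <= `|a| ^+ 2 * ((u *m u^T) 0 0)%:C%C.
    by rewrite mulr_ge0 ?exprn_ge0 // (lecR 0) ltW ?sqpos.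
  have Cb : 0 <= `|b| ^+ 2 * ((v *m v^T) 0 0)%:C%C.
    by rewrite mulr_ge0 ?exprn_ge0 // (lecR 0) ltW ?sqpos.
  case/orP: ab => [a0|b0].
    by rewrite ltr_wpDr // mulr_gt0 ?exprn_gt0 ?normr_gt0 // (ltcR 0) sqpos.
  by rewrite ltr_wpDl // mulr_gt0 ?exprn_gt0 ?normr_gt0 // (ltcR 0) sqpos.
have up : \sum_i (r 0 i)%:C%C * `|(w *m P^t*) 0 i| ^+ 2 <= c%:C%C * W.
  rewrite E1 E2 mulrDr !(mulrCA c%:C%C) -!rmorphM lerD //.
    by rewrite ler_wpM2l ?exprn_ge0 // lecR.
  by rewrite ler_wpM2l ?exprn_ge0 // lecR.
(* The coordinate [i0] of [w] vanishes, and every other eigenvalue is at least [l]. *)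
have lo : l%:C%C * W <= \sum_i (r 0 i)%:C%C * `|(w *m P^t*) 0 i| ^+ 2.
  rewrite mulr_sumr; apply: ler_sum => i _.
  have [->|ii] := eqVneq i i0; first by rewrite wz0 normr0 expr0n !mulr0.
  by rewrite ler_wpM2r ?exprn_ge0 // lecR hi0.
have := le_trans lo up; rewrite ler_pM2r // lecR leNgt.
by rewrite clt.
Qed.

Close Scope sesquilinear_scope.

(** * Levels of the distance to the boundary *)

Lemma graph_dist_self (V : finType) (e : rel V) x : graph_dist e x x = 0%N.
Proof.
have V0 : (0 < #|V|)%N by apply/card_gt0P; exists x.
rewrite /graph_dist; case: #|V| V0 => // k _ /=.
by case: existsP => // -[]; exists [tuple]; rewrite /= eqxx.
Qed.

Lemma graph_dist_eq0 (V : finType) (e : rel V) x y :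
  graph_dist e x y = 0%N -> x = y.
Proof.
have V0 : (0 < #|V|)%N by apply/card_gt0P; exists x.
rewrite /graph_dist; case: #|V| V0 => // k _ /=.
by case: existsP => // -[p]; rewrite (tuple0 p) /= => /eqP.
Qed.

(** Prepending the edge to a shortest walk from [y] gives a walk from [x]. When that walk is missing
    or too long for the search range, the cap [#|V|] on [graph_dist] gives the bound. *)
Lemma graph_dist_edge (V : finType) (e : rel V) x y z :
  e x y -> (graph_dist e x z <= (graph_dist e y z).+1)%N.
Proof.
move=> exy; rewrite /graph_dist.
set p1 := (X in (find X _ <= _)%N); set p2 := (X in (_ <= (find X _).+1)%N).
have szx : (find p1 (iota 0 #|V|) <= #|V|)%N.
  by rewrite -[X in (_ <= X)%N](size_iota 0 #|V|) find_size.
have [h2|] := boolP (has p2 (iota 0 #|V|)); last first.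
  by move=> h2; rewrite (hasNfind h2) size_iota; apply: leq_trans szx _.
have := nth_find 0%N h2; move: h2; rewrite has_find size_iota.
set m := find p2 _ => ltm; rewrite nth_iota // add0n => /existsP[q /andP[pq lq]].
have [ltm1|] := ltnP m.+1 #|V|; last exact: leq_trans.
rewrite leqNgt; apply/negP => ltf.
have := before_find 0%N ltf; rewrite nth_iota // add0n => /negbT/negP; apply.
by rewrite /p1; apply/existsP; exists (cons_tuple y q); rewrite /= exy pq.
Qed.

Lemma dist_to_set_le (V : finType) (e : rel V) (S : {set V}) x s :
  s \in S -> (dist_to_set e S x <= graph_dist e x s)%N.
Proof.
move=> sS; rewrite /dist_to_set; have := mem_index_enum s.
elim: (index_enum V) => // t r IH; rewrite inE big_cons => /predU1P[<-|/IH {}IH].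
  by rewrite sS geq_minl.
by case: ifP => // _; rewrite geq_min IH orbT.
Qed.

Lemma dist_to_set_attained (V : finType) (e : rel V) (S : {set V}) x :
  dist_to_set e S x = #|V| \/
  exists2 s, s \in S & dist_to_set e S x = graph_dist e x s.
Proof.
rewrite /dist_to_set; elim/big_ind: _ => [|a b ha hb|s sS]; first by left.
  by rewrite /minn; case: ifP.
by right; exists s.
Qed.

Lemma dist_to_set_leV (V : finType) (e : rel V) (S : {set V}) x :
  (dist_to_set e S x <= #|V|)%N.
Proof.
case: (dist_to_set_attained e S x) => [->//|[s _ ->]].
by rewrite -[X in (_ <= X)%N](size_iota 0 #|V|) find_size.
Qed.

Lemma dist_to_set_gt0 (V : finType) (e : rel V) (S : {set V}) x :
  (0 < dist_to_set e S x)%N = (x \notin S).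
Proof.
apply/idP/idP => [|xS].
  by apply: contraTN => xS; rewrite -leqNgt -[X in (_ <= X)%N](graph_dist_self e x) dist_to_set_le.
case: (dist_to_set_attained e S x) => [->|[s sS ->]].
  by apply/card_gt0P; exists x.
by rewrite lt0n; apply: contra xS => /eqP/graph_dist_eq0 ->.
Qed.

Lemma dist_to_set_edge (V : finType) (e : rel V) (S : {set V}) x y :
  e x y -> (dist_to_set e S x <= (dist_to_set e S y).+1)%N.
Proof.
move=> exy; case: (dist_to_set_attained e S y) => [->|[s sS ->]].
  exact: leq_trans (dist_to_set_leV _ _ _) _.
exact: leq_trans (dist_to_set_le e x sS) (graph_dist_edge s exy).
Qed.

(* Abstracts the distance to [S] inside the side [P], extended by 0. *)
Record side_height (V : finType) (e : rel V) (P S : {set V}) (l : V -> nat) : Prop :=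
  SideHeight {
    height_gt0 : forall x, (0 < l x)%N = (x \in P);
    height_edge : forall x y, e x y -> (l x <= (l y).+1)%N;
    height_nbr : forall x y, e x y -> x \in P -> y \in P :|: S }.

Definition level (V : finType) (P S : {set V}) (l : V -> nat) (k : nat) : {set V} :=
  [set x in P :|: S | l x == k].

(** The cut-off to 0 outside [P] keeps the one-step property: an edge leaving [P] ends in [S], where
    the distance is already 0. *)
Lemma dist_side_height (V : finType) (e : rel V) (P Q S : {set V}) :
  Q = ~: (P :|: S) -> [disjoint P & S] ->
  (forall x y, e x y -> x \in P -> y \notin Q) ->
  side_height e P S (fun x => if x \in P then dist_to_set e S x else 0%N).
Proof.
move=> QE dPS PQ.
have nbr x y : e x y -> x \in P -> y \in P :|: S.
  by move=> exy xP; have := PQ _ _ exy xP; rewrite QE finset.in_setC negbK.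
split=> // [x|x y exy].
  case: ifP => // xP; rewrite dist_to_set_gt0.
  by rewrite (disjointFr dPS xP).
case: ifP => // xP; have := dist_to_set_edge S exy.
case: ifP => // yP; have := nbr _ _ exy xP; rewrite finset.in_setU yP /= => yS.
by have := dist_to_set_gt0 e S y; rewrite yS; case: (dist_to_set e S y).
Qed.

(** Points of [Q] lie off [S], so their signed distance is strictly negative and no level [k >= 0]
    sees them. The two choices of signs therefore bound the levels of the two sides separately. *)
Lemma signed_dist_level (V : finType) (e : rel V) (P Q S : {set V}) k :
  Q = ~: (P :|: S) -> [disjoint P & S] ->
  [set x | signed_dist e S P Q x == k%:Z] =
  level P S (fun x => if x \in P then dist_to_set e S x else 0%N) k.
Proof.
move=> QE dPS; apply/setP => x; rewrite !inE /signed_dist QE !inE.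
case: (boolP (x \in P)) => xP //=.
case: (boolP (x \in S)) => xS //=; have := dist_to_set_gt0 e S x; rewrite xS.
by case: (dist_to_set e S x).
Qed.

Lemma sum_levels (R : nmodType) (V : finType) (P S : {set V}) l m n (F : V -> R) :
  \sum_(m <= i < n) \sum_(x in level P S l i) F x =
  \sum_(x in P :|: S | (m <= l x < n)%N) F x.
Proof.
rewrite big_nat.
rewrite (exchange_big_dep (fun x => (x \in P :|: S) && (m <= l x < n)%N)) /=; last first.
  by move=> i x lei; rewrite inE => /andP[-> /eqP->].
apply: eq_bigr => x /andP[xP lx].
rewrite -big_filter (_ : [seq i <- _ | _] = [:: l x]) ?big_seq1 //.
apply: perm_small_eq => //; apply: uniq_perm => //.
  by rewrite filter_uniq // iota_uniq.
move=> i; rewrite mem_filter mem_index_iota /level finset.inE xP mem_seq1 /= eq_sym.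
by case: eqP => [->|_]; rewrite ?lx ?andbF.
Qed.

Lemma card_le_levels (V : finType) (P S : {set V}) l k :
  (#|P :|: S| <= \sum_(0 <= i < k.+1) #|level P S l i| + #|[set x | (k < l x)%N]|)%N.
Proof.
have -> : (\sum_(0 <= i < k.+1) #|level P S l i| = #|[set x in P :|: S | (l x <= k)%N]|)%N.
  under eq_bigr => i _ do rewrite -sum1_card.
  rewrite (@sum_levels nat) -sum1_card; apply: eq_bigl => x.
  by rewrite !inE ltnS.
rewrite -[leqLHS](cardsID [set x | (l x <= k)%N]) leq_add //; apply: subset_leq_card.
  by apply/fintype.subsetP => x; rewrite !inE.
by apply/fintype.subsetP => x; rewrite !inE ltnNge => /andP[].
Qed.

(** Heights change by at most one along an edge, so a boundary point has height exactly [k]; since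
    [k > 0], it lies in [P]. *)
Lemma boundary_above_height (V : finType) (e : rel V) (P S : {set V}) l k :
  side_height e P S l -> (0 < k)%N ->
  outer_boundary e [set x | (k < l x)%N] \subset level P S l k.
Proof.
move=> hl k0; apply/fintype.subsetP => y; rewrite !inE -leqNgt => /andP[lyk /existsP[x]].
rewrite inE => /andP[kx exy].
have lk : l y = k by apply/eqP; rewrite eqn_leq lyk -ltnS (leq_trans kx (height_edge hl exy)).
by rewrite -(height_gt0 hl) lk k0 eqxx.
Qed.

Lemma boundary_below_height (V : finType) (e : rel V) (P S : {set V}) l k :
  symmetric e -> side_height e P S l -> (0 < k)%N ->
  outer_boundary e [set x | (l x < k)%N] \subset level P S l k.
Proof.
move=> es hl k0; apply/fintype.subsetP => y; rewrite !inE -leqNgt => /andP[lyk /existsP[x]].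
rewrite inE => /andP[kx exy].
have lk : l y = k.
  apply/eqP; rewrite eqn_leq lyk andbT.
  by rewrite es in exy; apply: leq_trans (height_edge hl exy) _.
by rewrite -(height_gt0 hl) lk k0 eqxx.
Qed.

(** * Isoperimetric lower bound on the levels *)

Lemma h_out_le (R : realType) (V : finType) (e : rel V) (A : {set V}) :
  (2 * #|A| <= #|V|)%N -> h_out R e * #|A|%:R <= #|outer_boundary e A|%:R.
Proof.
move=> A2; have [->|A0] := eqVneq A finset.set0.
  by rewrite cards0 mulr0.
rewrite -ler_pdivlMr ?ltr0n ?card_gt0 //; apply: ge_inf.
  by exists 0 => _ [B _ ->]; rewrite divr_ge0.
by exists A => //; rewrite /admissible A0.
Qed.

Lemma level_lower_bound (R : realType) (V : finType) (e : rel V) (A P S : {set V})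
    (l : V -> nat) (nu : nat -> R) (k : nat) :
  symmetric e -> side_height e P S l -> (0 < k)%N ->
  h_out R e * #|A|%:R = #|S|%:R -> 0 <= h_out R e ->
  (#|A| <= #|P :|: S|)%N -> (#|A| <= #|~: P|)%N ->
  (forall i, #|level P S l i|%:R <= #|S|%:R * nu i) -> (forall i, 0 < nu i) ->
  #|S|%:R * (1 - h_out R e * \sum_(0 <= i < k.+1) nu i) <= #|level P S l k|%:R.
Proof.
move=> es hl k0; set h := h_out R e => hA h0 AP ACP hnu nu0.
have sub0 : 0 <= \sum_(0 <= i < k.+1) nu i by rewrite sumr_ge0 // => i _; exact: ltW.
(* First case: the points above [k] number at least [|A| - |S| \sum_(i <= k) nu i]; multiply by [h]
   and use [h |A| = |S|]. *)
have [le2|gt2] := leqP (2 * #|[set x | (k < l x)%N]|) #|V|.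
  have := card_le_levels P S l k; rewrite -(ler_nat R) natrD natr_sum => cl.
  have sl : \sum_(0 <= i < k.+1) #|level P S l i|%:R <= #|S|%:R * \sum_(0 <= i < k.+1) nu i :> R.
    by rewrite mulr_sumr ler_sum.
  have iso := h_out_le R e le2.
  have bd : #|outer_boundary e [set x | (k < l x)%N]|%:R <= #|level P S l k|%:R :> R.
    by rewrite ler_nat subset_leq_card // boundary_above_height.
  apply: le_trans (le_trans iso bd); rewrite -/h -hA.
  set a := #|A|%:R; set t := \sum_(_ <= _ < _) _.
  have -> : h * a * (1 - h * t) = h * (a - h * a * t) by ring.
  rewrite ler_wpM2l //.
  have : a <= #|P :|: S|%:R :> R by rewrite ler_nat.
  by rewrite -hA -/a -/t in sl; move: sl cl; lra.
(* Second case: the points below [k] are disjoint from a majority, and they include the complement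
   of [P], hence number at least [|A|]. This gives [|L_k| >= h |A| = |S|], more than required. *)
have le2 : (2 * #|[set x | (l x < k)%N]| <= #|V|)%N.
  have : (#|[set x | (l x < k)%N]| + #|[set x | (k < l x)%N]| <= #|V|)%N.
    rewrite -cardsUI [X in (_ + X)%N](_ : _ = 0%N) ?addn0 ?max_card //.
    apply/eqP; rewrite cards_eq0; apply/eqP/setP => x; rewrite !inE.
    by apply/negP => /andP[/ltn_trans h1 /h1]; rewrite ltnn.
  lia.
have iso := h_out_le R e le2.
have bd : #|outer_boundary e [set x | (l x < k)%N]|%:R <= #|level P S l k|%:R :> R.
  by rewrite ler_nat subset_leq_card // boundary_below_height.
apply: le_trans (le_trans iso bd).
apply: (@le_trans _ _ #|S|%:R).
  by rewrite ler_piMr // gerBl mulr_ge0.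
rewrite -/h -hA ler_wpM2l // ler_nat (leq_trans ACP) // subset_leq_card //.
apply/fintype.subsetP => x; rewrite !inE -(height_gt0 hl) -leqNgt leqn0 => /eqP ->.
exact: k0.
Qed.

(** * The test functions *)

(** The increment of the test profile from height [j - 1] to [j]. It vanishes past [n], where the
    profile is constant, and at [j = 0], below which there is no level. *)
Definition hardy_step (R : realType) (nu : nat -> R) (n j : nat) : R :=
  if (0 < j <= n)%N then (nu j + nu j.-1)^-1 else 0.

Definition hardy_fun (R : realType) (nu : nat -> R) (n k : nat) : R :=
  \sum_(1 <= j < k.+1) hardy_step nu n j.

Lemma hardy_fun0 (R : realType) (nu : nat -> R) n : hardy_fun nu n 0 = 0.
Proof. by rewrite /hardy_fun big_geq. Qed.

Lemma hardy_funS (R : realType) (nu : nat -> R) n k :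
  hardy_fun nu n k.+1 = hardy_fun nu n k + hardy_step nu n k.+1.
Proof. by rewrite /hardy_fun big_nat_recr. Qed.

Lemma hardy_fun_nn (R : realType) (nu : nat -> R) n :
  hardy_fun nu n n = \sum_(1 <= k < n.+1) (nu k + nu k.-1)^-1.
Proof.
rewrite /hardy_fun big_nat [RHS]big_nat; apply: eq_bigr => k.
by rewrite /hardy_step ltnS => ->.
Qed.

Lemma hardy_fun_ge (R : realType) (nu : nat -> R) n k :
  (n <= k)%N -> hardy_fun nu n k = hardy_fun nu n n.
Proof.
move=> /subnK <-; elim: (k - n)%N => [|m IH] //.
by rewrite addSn hardy_funS IH /hardy_step /= ltnNge leq_addl addr0.
Qed.

Lemma hardy_step_ge0 (R : realType) (nu : nat -> R) n j :
  (forall i, 0 < nu i) -> 0 <= hardy_step nu n j.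
Proof. by move=> nu0; rewrite /hardy_step; case: ifP => // _; rewrite invr_ge0 addr_ge0 // ltW. Qed.

Lemma hardy_fun_le (R : realType) (nu : nat -> R) n k :
  (forall i, 0 < nu i) -> hardy_fun nu n k <= hardy_fun nu n n.
Proof.
move=> nu0; have [/hardy_fun_ge->//|kn] := leqP n k.
rewrite {2}/hardy_fun (@big_cat_nat _ _ _ k.+1) //=; last exact: ltnW.
by rewrite lerDl sumr_ge0 // => j _; exact: hardy_step_ge0.
Qed.

(** Regrouped by increments, step [j] is charged by levels [j - 1] and [j], with total weight
    [nu j + nu (j - 1)], the inverse of the step when it is nonzero; weight times squared step is
    then the step itself. The isolated term is what level [N] owes to step [N]. *)
Lemma hardy_step_sum (R : realType) (nu : nat -> R) n N :
  (forall i, 0 < nu i) ->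
  \sum_(0 <= k < N) nu k * (hardy_step nu n k ^+ 2 + hardy_step nu n k.+1 ^+ 2)
    + nu N * hardy_step nu n N ^+ 2 = hardy_fun nu n N.
Proof.
move=> nu0; elim: N => [|N IH].
  by rewrite big_geq // hardy_fun0 {1}/hardy_step /= expr0n mulr0 addr0.
rewrite big_nat_recr //= hardy_funS -IH.
have : hardy_step nu n N.+1 = (nu N.+1 + nu N) * hardy_step nu n N.+1 ^+ 2 :> R.
  rewrite /hardy_step; case: ifP => _; last by rewrite expr0n mulr0.
  by rewrite expr2 mulrA divff ?mul1r // gt_eqF // addr_gt0.
lra.
Qed.

Lemma energy_le (R : realType) (V : finType) (e : rel V) (d : nat) (P S : {set V})
    (l : V -> nat) (nu : nat -> R) (n : nat) :
  symmetric e -> regular_graph e d -> side_height e P S l ->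
  (forall i, #|level P S l i|%:R <= #|S|%:R * nu i) -> (forall i, 0 < nu i) ->
  \sum_x \sum_(y | e x y) (hardy_fun nu n (l x) - hardy_fun nu n (l y)) ^+ 2 <=
  d%:R * (#|S|%:R * hardy_fun nu n n).
Proof.
move=> es reg hl hnu nu0.
pose q k := hardy_step nu n k ^+ 2 + hardy_step nu n k.+1 ^+ 2.
have q0 k : 0 <= q k by rewrite addr_ge0 ?sqr_ge0.
(* All heights are below [N], so the levels under [N] exhaust [P :|: S]. *)
pose N := (\max_x l x).+1.
have pair x y : e x y -> (hardy_fun nu n (l x) - hardy_fun nu n (l y)) ^+ 2 <= q (l x).
  move=> exy; have lxy := height_edge hl exy.
  have lyx : (l y <= (l x).+1)%N by apply: (height_edge hl); rewrite es.
  have [lt|lt|->] := ltngtP (l x) (l y); last by rewrite subrr expr0n.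
    have -> : l y = (l x).+1 by apply/eqP; rewrite eqn_leq lyx lt.
    by rewrite hardy_funS opprD addNKr sqrrN lerDr sqr_ge0.
  have -> : l x = (l y).+1 by apply/eqP; rewrite eqn_leq lxy lt.
  by rewrite hardy_funS addrC addKr lerDl sqr_ge0.
(* Each of the [d] neighbours costs at most [q (l x)]. Outside [P :|: S] the vertex and its
   neighbours all have height 0, a neighbour in [P] being impossible. *)
have vert x : \sum_(y | e x y) (hardy_fun nu n (l x) - hardy_fun nu n (l y)) ^+ 2 <=
    if x \in P :|: S then d%:R * q (l x) else 0.
  case: ifP => xPS.
    apply: (@le_trans _ _ (\sum_(y | e x y) q (l x))).
      by apply: ler_sum => y exy; exact: pair.
    by rewrite sumr_const -cardsE reg mulr_natl.
  rewrite big1 // => y exy.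
  have xP : x \in P = false by move: xPS; rewrite finset.in_setU; case: (x \in P).
  have yP : y \in P = false.
    apply/negP => yP; suff : x \in P :|: S by rewrite xPS.
    by apply: (height_nbr hl _ yP); rewrite es.
  have -> : l x = 0%N by apply/eqP; rewrite -leqn0 leqNgt (height_gt0 hl) xP.
  have -> : l y = 0%N by apply/eqP; rewrite -leqn0 leqNgt (height_gt0 hl) yP.
  by rewrite subrr expr0n.
apply: le_trans (ler_sum _ (fun x _ => vert x)) _.
rewrite -big_mkcond /= -mulr_sumr ler_wpM2l //.
have -> : \sum_(x in P :|: S) q (l x) =
    \sum_(0 <= k < N) #|level P S l k|%:R * q k.
  transitivity (\sum_(0 <= k < N) \sum_(x in level P S l k) q (l x)).
    rewrite sum_levels; apply: eq_bigl => x.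
    have lx : (l x <= \max_z l z)%N by exact: leq_bigmax.
    by rewrite /N ltnS lx leq0n !andbT.
  apply: eq_bigr => k _; rewrite mulr_natl -sumr_const; apply: eq_bigr => x.
  by rewrite finset.inE => /andP[_ /eqP ->].
apply: (@le_trans _ _ (#|S|%:R * \sum_(0 <= k < N) nu k * q k)).
  by rewrite mulr_sumr ler_sum // => k _; rewrite mulrA ler_wpM2r.
rewrite ler_wpM2l //; apply: le_trans (hardy_fun_le n N nu0).
by rewrite -hardy_step_sum // lerDl mulr_ge0 ?sqr_ge0 // ltW.
Qed.

(** Only levels from [n] on are kept: there the profile has reached its constant value
    [hardy_fun nu n n]. *)
Lemma norm_ge (R : realType) (V : finType) (P S : {set V}) (l : V -> nat)
    (nu : nat -> R) (w : nat -> R) (n t : nat) :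
  (forall k, (n <= k)%N -> #|S|%:R * w k <= #|level P S l k|%:R) ->
  #|S|%:R * hardy_fun nu n n ^+ 2 * (\sum_(n <= k < t) w k) <=
  \sum_x hardy_fun nu n (l x) ^+ 2.
Proof.
move=> lw.
apply: (@le_trans _ _ (\sum_(n <= k < t) \sum_(x in level P S l k) hardy_fun nu n (l x) ^+ 2)).
  rewrite mulr_sumr big_nat [leRHS]big_nat; apply: ler_sum => k /andP[nk _].
  rewrite mulrAC; apply: le_trans (ler_wpM2r (sqr_ge0 _) (lw _ nk)) _.
  rewrite mulr_natl -sumr_const; apply: ler_sum => x.
  by rewrite finset.inE => /andP[_ /eqP ->]; rewrite hardy_fun_ge.
rewrite sum_levels [leLHS]big_mkcond; apply: ler_sum => x _.
by case: ifP => // _; rewrite sqr_ge0.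
Qed.

(** * The Laplacian as a quadratic form *)

Definition vertex_row (R : realType) (V : finType) (f : V -> R) : 'rV[R]_#|V| :=
  \row_i f (enum_val i).

Lemma sum_enum_val (R : nmodType) (V : finType) (F : V -> R) :
  \sum_(i < #|V|) F (enum_val i) = \sum_x F x.
Proof. by rewrite [RHS](reindex (@enum_val V V)) //; apply: onW_bij; exact: enum_val_bij. Qed.

Lemma vertex_row_dot (R : realType) (V : finType) (f g : V -> R) :
  (vertex_row f *m (vertex_row g)^T) 0 0 = \sum_x f x * g x.
Proof.
by rewrite mxE -[RHS]sum_enum_val; apply: eq_bigr => i _; rewrite !mxE.
Qed.

Lemma laplacian_mx_col (R : realType) (V : finType) (e : rel V) d (g : V -> R) i :
  \sum_j laplacian_mx R e d i j * g (enum_val j) = laplacian e d g (enum_val i).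
Proof.
have delta (x : V) : \sum_z (x == z)%:R * g z = g x.
  rewrite (bigD1 x) //= eqxx mul1r big1 ?addr0 // => z /negPf.
  by rewrite eq_sym => ->; rewrite mul0r.
under eq_bigr => j _ do rewrite mxE /laplacian -mulrA.
rewrite -mulr_sumr /laplacian; congr (_ * _).
rewrite (sum_enum_val (fun z =>
  (\sum_(y | e (enum_val i) y) ((enum_val i == z)%:R - (y == z)%:R)) * g z)).
under eq_bigr => z _ do rewrite mulr_suml.
rewrite exchange_big; apply: eq_bigr => y _ /=.
under eq_bigr => z _ do rewrite mulrBl.
by rewrite sumrB !delta.
Qed.

Lemma vertex_row_laplacian (R : realType) (V : finType) (e : rel V) d (f g : V -> R) :
  (vertex_row f *m laplacian_mx R e d *m (vertex_row g)^T) 0 0 =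
  \sum_x f x * laplacian e d g x.
Proof.
rewrite -mulmxA mxE -[RHS]sum_enum_val; apply: eq_bigr => i _; rewrite mxE; congr (_ * _).
by rewrite mxE -laplacian_mx_col; apply: eq_bigr => j _; rewrite !mxE.
Qed.

(** Regularity makes the diagonal contribution the same at every vertex, leaving a multiple of the
    identity minus a multiple of the adjacency matrix. *)
Lemma laplacian_mx_sym (R : realType) (V : finType) (e : rel V) d :
  symmetric e -> regular_graph e d -> (laplacian_mx R e d)^T = laplacian_mx R e d.
Proof.
move=> es reg.
have E x z : laplacian e d (fun y => (y == z)%:R) x =
    d%:R^-1 * ((x == z)%:R *+ d - (e x z)%:R) :> R.
  rewrite /laplacian sumrB sumr_const -cardsE reg; congr (_ * (_ - _)).

  rewrite big_mkcond (bigD1 z) //= eqxx big1 ?addr0 => [|y /negPf yz]; first by case: (e x z).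
  by case: ifP; rewrite ?yz.
by apply/matrixP => i j; rewrite !mxE !E es eq_sym.
Qed.

(** Symmetrize by swapping the endpoints; the factor 1/2 appears because the sum runs over ordered
    pairs. *)
Lemma laplacian_energy (R : realType) (V : finType) (e : rel V) d (f : V -> R) :
  symmetric e ->
  \sum_x f x * laplacian e d f x =
  d%:R^-1 / 2%:R * \sum_x \sum_(y | e x y) (f x - f y) ^+ 2.
Proof.
move=> es; pose B := \sum_x \sum_(y | e x y) f x * (f x - f y).
have BE : B = \sum_x \sum_(y | e x y) f y * (f y - f x).
  rewrite /B (exchange_big_dep xpredT) //=; apply: eq_bigr => x _.
  by apply: eq_bigl => y; rewrite es.
have -> : \sum_x \sum_(y | e x y) (f x - f y) ^+ 2 = B + B.
  rewrite {2}BE -big_split; apply: eq_bigr => x _ /=; rewrite -big_split.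
  by apply: eq_bigr => y _ /=; ring.
rewrite /laplacian; under eq_bigr => x _ do rewrite mulrCA mulr_sumr.
by rewrite -mulr_sumr -/B; move: (d%:R^-1) => c; field.
Qed.

(** With [G = hardy_fun nu n n], the energy is at most [|S| G / 2] and the squared norm at least
    [|S| G b], whence the quotient [1 / (2 b)]. *)
Lemma side_rayleigh (R : realType) (V : finType) (e : rel V) (d : nat)
    (A P S : {set V}) (l : V -> nat) (nu : nat -> R) (n t : nat) :
  symmetric e -> regular_graph e d -> side_height e P S l -> (0 < n)%N ->
  (0 < #|S|)%N -> h_out R e * #|A|%:R = #|S|%:R -> 0 <= h_out R e ->
  (#|A| <= #|P :|: S|)%N -> (#|A| <= #|~: P|)%N ->
  (forall i, #|level P S l i|%:R <= #|S|%:R * nu i) -> (forall i, 0 < nu i) ->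
  let f x := hardy_fun nu n (l x) in
  let b := (\sum_(n <= k < t) (1 - h_out R e * \sum_(0 <= i < k.+1) nu i))
           * hardy_fun nu n n in
  0 < b ->
  0 < \sum_x f x * f x /\
  \sum_x f x * laplacian e d f x <= (2%:R * b)^-1 * \sum_x f x * f x.
Proof.
move=> es reg hl n0 S0 hA h0 AP ACP hnu nu0 f; set W := \sum_(_ <= _ < _) _.
set G := hardy_fun nu n n => b b0; have b2 := mulr_gt0 (ltr0n R 2) b0.
have G0 : 0 <= G by rewrite sumr_ge0 // => j _; exact: hardy_step_ge0.
have Gp : 0 < G.
  by rewrite lt_def G0 andbT; apply: contraTneq b0 => GE; rewrite /b GE mulr0 ltxx.
have s0 : 0 < #|S|%:R :> R by rewrite ltr0n.
have nrm : #|S|%:R * G * b <= \sum_x f x * f x.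
  under eq_bigr => x _ do rewrite -expr2.
  rewrite (_ : _ * b = #|S|%:R * G ^+ 2 * W); last by rewrite /b; ring.
  apply: norm_ge => k nk.
  exact: (level_lower_bound es hl (leq_trans n0 nk) hA h0 AP ACP hnu nu0).
have sGb : 0 < #|S|%:R * G * b by rewrite mulr_gt0 // mulr_gt0.
split; first exact: lt_le_trans sGb nrm.
rewrite laplacian_energy // ler_pdivlMl //; apply: le_trans nrm.
have En : \sum_x \sum_(y | e x y) (f x - f y) ^+ 2 <= d%:R * (#|S|%:R * G).
  exact: (energy_le n es reg hl hnu nu0).
set E := \sum_x _ in En *.
have dE : d%:R^-1 * E <= #|S|%:R * G.
  (* For [d = 0] the convention that 0 has inverse 0 makes the left side vanish. *)
  have [d0|d0] := posnP d.
    by rewrite d0 invr0 mul0r mulr_ge0 // ltW.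
  by rewrite ler_pdivrMl ?ltr0n.
rewrite (_ : 2%:R * b * _ = d%:R^-1 * E * b); last first.
  by move: (d%:R^-1) => c; field.
by rewrite ler_wpM2r // ltW.
Qed.

(** With an empty boundary, [A] would be closed under adjacency and so, by connectedness, contain
    every vertex. *)
Lemma connected_boundary_gt0 (V : finType) (e : rel V) (A : {set V}) :
  symmetric e -> connected_graph e -> A != finset.set0 -> (#|A| < #|V|)%N ->
  (0 < #|outer_boundary e A|)%N.
Proof.
move=> es conn /set0Pn[x xA] AV; rewrite card_gt0; apply/negP => /eqP B0.
have step y z : e y z -> y \in A -> z \in A.
  move=> eyz yA; apply/negPn/negP => zA.
  have : z \in outer_boundary e A.
    by rewrite finset.inE zA; apply/existsP; exists y; rewrite yA.
  by rewrite B0 finset.in_set0.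
have cl : fingraph.closed e A.
  by move=> y z eyz; apply/idP/idP; apply: step => //; rewrite es.
have : [set: V] \subset A.
  by apply/fintype.subsetP => y _; rewrite -(closed_connect cl (conn x y)).
by move/subset_leq_card; rewrite cardsT leqNgt AV.
Qed.

(* In [\bar R] the inverse of 0 is +oo, so the bound is void when the supremum is 0. *)
Theorem theorem5p11 (R : realType) (V : finType) (e : rel V) (d : nat)
    (A : {set V}) (nu : nat -> R) (T : int) :
  simple_graph e ->
  connected_graph e ->
  regular_graph e d ->
  A != finset.set0 ->
  (2 * #|A| <= #|V|)%N ->
  h_out R e = #|outer_boundary e A|%:R / #|A|%:R ->
  (forall k, 0 < nu k) ->
  let Sigma := outer_boundary e A in
  level_bound e Sigma A (~: (A :|: Sigma)) nu ->
  level_bound e Sigma (~: (A :|: Sigma)) A nu ->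
  is_largest_int (fun t : int => 1 > h_out R e * sum_upto 0 t nu) T ->
  ((lambda_ R e d 2)%:E <= (2%:E * hardy_const (h_out R e) nu T)^-1)%E.
Proof.
move=> [es _] conn reg A0 A2 hE nu0 S hnuA hnuC _.
set h := h_out R e; set lam := lambda_ R e d 2.
have A0' : (0 < #|A|)%N by rewrite card_gt0.
have S0 : (0 < #|S|)%N by apply: connected_boundary_gt0 => //; lia.
have hA : h * #|A|%:R = #|S|%:R by rewrite /h hE divfK // pnatr_eq0 -lt0n.
have h0 : 0 <= h by rewrite /h hE divr_ge0.
set C := ~: (A :|: S) in hnuA hnuC.
have dAS : [disjoint A & S].
  by rewrite disjoint_subset; apply/fintype.subsetP => x xA; rewrite !inE xA.
have dCS : [disjoint C & S].
  by rewrite disjoint_subset; apply/fintype.subsetP => x; rewrite !inE => /norP[].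
have AE : A = ~: (C :|: S).
  apply/setP => x; rewrite finset.in_setC finset.in_setU finset.in_setC finset.in_setU.
  case: (boolP (x \in A)) => xA /=; first by rewrite (disjointFr dAS xA).
  by case: (x \in S).
have noAC x y : e x y -> x \in A -> y \notin C.
  move=> exy xA; rewrite finset.in_setC negbK finset.in_setU finset.inE.
  by case: (boolP (y \in A)) => //= _; apply/existsP; exists x; rewrite xA.
have noCA x y : e x y -> x \in C -> y \notin A.
  by move=> exy xC; apply/negP => yA; have := noAC y x; rewrite es exy xC yA => /(_ isT isT).
pose lA x := if x \in A then dist_to_set e S x else 0%N.
pose lC x := if x \in C then dist_to_set e S x else 0%N.
have hlA : side_height e A S lA by apply: dist_side_height (erefl C) dAS noAC.
have hlC : side_height e C S lC by apply: dist_side_height AE dCS noCA.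
have nuA i : #|level A S lA i|%:R <= #|S|%:R * nu i.
  by rewrite -(signed_dist_level e i (erefl C) dAS); exact: hnuA.
have nuC i : #|level C S lC i|%:R <= #|S|%:R * nu i.
  by rewrite -(signed_dist_level e i AE dCS); exact: hnuC.
(* The value 0 is attained at [n = T + 1], or at [n = 1] if [T] is negative, where the first factor
   is an empty sum. *)
have B0 : (0 <= hardy_const h nu T)%E.
  apply: ereal_sup_ubound; case: T => [t|t]; last first.
    by exists 1%N => //=; rewrite mul0r.
  by exists t.+1 => //=; rewrite big_geq // mul0r.
have B20 : (0 <= 2%:E * hardy_const h nu T)%E by rewrite mule_ge0 // lee_fin.
have [lam0|lam0] := leP lam 0.
  by apply: le_trans (_ : 0 <= _)%E; rewrite ?lee_fin ?inve_ge0.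
(* For positive [lam] the claim inverts to [2 B <= 1 / lam], which can be checked on each term of
   the supremum. *)
rewrite inve_pge ?inE ?lee_fin ?(ltW lam0) // inver gt_eqF //.
rewrite -lee_pdivlMl // -EFinM; apply: ge_ereal_sup => _ [n n0 ->]; rewrite lee_fin.
set G := \sum_(1 <= k < _) _; set W := sum_upto _ _ _.
have [b0|b0] := leP (W * G) 0; first by apply: le_trans b0 _; rewrite mulr_ge0 ?invr_ge0 // ltW.
suff lamb : lam <= (2%:R * (W * G))^-1.
  have b2 := mulr_gt0 (ltr0n R 2) b0; have lam2 := mulr_gt0 (ltr0n R 2) lam0.
  move: lamb; rewrite -invfM -[X in _ <= X]mul1r ler_pdivlMr //.
  by rewrite -[X in _ -> _ <= X]mul1r ler_pdivlMr //; lra.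
case: T @W b0 {B0 B20} => [t|t] W b0; last by rewrite mul0r ltxx in b0.
have GE : G = hardy_fun nu n n by rewrite hardy_fun_nn.
rewrite /W /= GE in b0 *.
have ACA : (#|A| <= #|~: A|)%N by rewrite -(leq_add2l #|A|) cardsC addnn -mul2n.
have AAS : (#|A| <= #|A :|: S|)%N by rewrite subset_leq_card // finset.subsetUl.
have ACC : (#|A| <= #|~: C|)%N.
  by rewrite /C finset.setCK.
(* Here [C :|: S] is the complement of [A], which holds at least half of the vertices. *)
have ACS : (#|A| <= #|C :|: S|)%N.
  by apply: leq_trans ACA _; rewrite [X in ~: X]AE finset.setCK.
have [Au Ac] := side_rayleigh es reg hlA n0 S0 hA h0 AAS ACA nuA nu0 b0.
have [Cu Cc] := side_rayleigh es reg hlC n0 S0 hA h0 ACS ACC nuC nu0 b0.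
set fA := fun x => hardy_fun nu n (lA x) in Au Ac.
set fC := fun x => hardy_fun nu n (lC x) in Cu Cc.
have fA0 x : x \notin A -> fA x = 0 by move=> xA; rewrite /fA /lA (negPf xA) hardy_fun0.
have fC0 x : x \notin C -> fC x = 0 by move=> xC; rewrite /fC /lC (negPf xC) hardy_fun0.
have notAC x : x \in A -> x \notin C by move=> xA; rewrite finset.in_setC finset.in_setU xA.
apply: (@nth1_real_eigenvalues_le _ _ _ (vertex_row fA) (vertex_row fC)).
- exact: laplacian_mx_sym.
- by rewrite invr_ge0 mulr_ge0 // ltW.
- by apply: contraTneq Au => f0; rewrite -vertex_row_dot f0 mul0mx mxE ltxx.
- by apply: contraTneq Cu => f0; rewrite -vertex_row_dot f0 mul0mx mxE ltxx.
- apply/matrixP => i j; rewrite !ord1 vertex_row_dot mxE big1 // => x _.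
  have [/notAC/fC0->|/fA0->] := boolP (x \in A); by rewrite ?mulr0 ?mul0r.
- apply/matrixP => i j; rewrite !ord1 vertex_row_laplacian mxE big1 // => x _.
  have [xA|/fA0->] := boolP (x \in A); last by rewrite mul0r.
  (* A vertex of [A] and its neighbours all avoid [C], so the Laplacian of [fC] vanishes on [A]. *)
  rewrite /laplacian big1 ?mulr0 // => y exy.
  by rewrite (fC0 x (notAC _ xA)) (fC0 y (noAC _ _ exy xA)) subrr.
- by rewrite vertex_row_laplacian vertex_row_dot.
- by rewrite vertex_row_laplacian vertex_row_dot.
Qed.
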